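(* Assume that Dickson's conjecture holds. For any positive integer $H$, there exist positive integers $M, m_1, \ldots, m_H$ such that for every integer $h \in [1, H]$, $$\varphi(m_h) = M + 4h,$$ where $\varphi$ is Euler's totient function.
   Context: A prime number $p$ is a fixed prime divisor of a polynomial $G$ with integer coefficients if $p \mid G(t)$ for all $t \in \mathbb{Z}$. Dickson's conjecture is the following assertion: let $s$ be a positive integer and let $F_1, F_2, \ldots, F_s$ be $s$ linear (degree one) polynomials with integral coefficients and positive leading coefficient such that their product $F_1 F_2 \cdots F_s$ has no fixed prime divisor; then there exist infinitely many positive integers $t$ such that $F_1(t), F_2(t), \ldots, F_s(t)$ are all primes. *)

(* Defs.v *)
From HB Require Import structures.
From mathcomp Require Import all_boot all_order all_algebra.
Set Implicit Arguments.
Unset Strict Implicit.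
Unset Printing Implicit Defensive.
Import Order.TTheory GRing.Theory Num.Theory.
Local Open Scope ring_scope.

Definition fixed_prime_divisor (p : nat) (G : {poly int}) : Prop :=
  prime p /\ forall t : int, (p%:Z %| G.[t])%Z.

(* A negative integer is never prime here, even if its absolute value is. *)
Definition prime_int (x : int) : Prop := exists2 p : nat, prime p & x = p%:Z.

(* [size F = 2] means degree one. The set of suitable [t] is infinite because
   it is an unbounded set of natural numbers; [N < t] makes [t] positive. *)
Definition Dickson_conjecture : Prop :=
  forall (s : nat) (F : 'I_s -> {poly int}),
    (0 < s)%N ->
    (forall i, size (F i) = 2%N) ->
    (forall i, 0 < lead_coef (F i)) ->
    (forall p : nat, ~ fixed_prime_divisor p (\prod_(i < s) F i)) ->
    forall N : nat, exists2 t : nat, (N < t)%N &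
      forall i, prime_int (F i).[t%:Z].

(* Main.v *)
Require Import Defs.
From mathcomp Require Import all_boot all_order all_algebra.
From mathcomp Require Import zify.
Import GRing.Theory Num.Theory.

(** If [d] is the totient of [w] and divides [n], and [p = n / d + 1] is a
    prime that does not divide [w], then [totient (w * p) = d * (p - 1) = n].
    So it suffices to find totients [d_1, ..., d_H] and an arithmetic
    progression of values of [M] such that [d_h] divides [M + 4 * h] for all
    [h] and all values, and then to apply Dickson's conjecture to the [H]
    linear forms [(M + 4 * h) / d_h + 1].  The only difficulty is to prevent
    fixed prime divisors of their product.

    With all [d_h = 1], every odd prime up to [H] would be fixed.  The form of
    index [h] vanishes modulo a prime [l] not dividing [d_h] exactly when
    [M + 4 * h + d_h = 0] modulo [l]; so [d_h] has to avoid one nonzero residue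
    class, or only the class [0], modulo [l].  Moreover [d_h] should be twice an
    odd number, so that [(M + 4 * h) / d_h] is even and the form is odd, and so
    that the divisibility conditions on [M] for distinct [h] can be made
    compatible: then every [M + 4 * h] is divisible by [4], and the odd parts of
    the [d_h] can be coprime.  Such totients are supplied by
    [totient_avoiding]: they are [q - 1] or [q * (q - 1)] for a prime [q] in a
    suitable arithmetic progression.  That [q] exists is Dirichlet's theorem,
    which is the case of a single form of Dickson's conjecture.  Both shapes are
    needed: modulo [3] the first is [1] and the second is [2] for
    [q = 2], the only class left.

    The totients are chosen one after another in [compatibleS], each with all
    its odd prime factors larger than everything chosen before.
    For the final forms, [compatible_not_fixed] finds a good argument for each
    prime [l], where [L] is the difference of the progression of [M]:
    - [l = 2]: all forms are odd;
    - [l] does not divide [L]: then [l > H], and each form has a single root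
      modulo [l] ([avoid_zeros]);
    - [l] divides [L] and some [d_j]: only the form of index [j] depends on the
      argument modulo [l], the others are nonzero constants;
    - [l] divides [L] and no [d_j]: all forms are nonzero constants. *)

(** * Dickson's conjecture for natural numbers *)

(** A prime that divides a product divides one of the factors; so a prime is not
    a fixed divisor as soon as no form vanishes modulo it at some argument. *)
Lemma Dickson_nat (s : nat) (a b : nat -> nat) (N : nat) :
  Dickson_conjecture -> 0 < s ->
  (forall i, i < s -> 0 < b i) ->
  (forall p, prime p -> exists t, forall i, i < s -> ~~ (p %| a i + b i * t)) ->
  exists2 t, N < t & forall i, i < s -> prime (a i + b i * t).
Proof.
move=> Dickson s_gt0 b_gt0 not_fixed.
pose F (i : 'I_s) : {poly int} := (Posz (b i) *: 'X + (Posz (a i))%:P)%R.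
have FE (i : 'I_s) (t : nat) : (F i).[Posz t]%R = Posz (a i + b i * t).
  by rewrite /F !hornerE PoszD PoszM addrC.
have bX_size (i : 'I_s) : size (Posz (b i) *: 'X : {poly int})%R = 2.
  by rewrite size_scale ?size_polyX // -[0%R]/(Posz 0) eqz_nat -lt0n b_gt0.
have size_lt (i : 'I_s) :
    size ((Posz (a i))%:P : {poly int})%R
      < size (Posz (b i) *: 'X : {poly int})%R.
  by rewrite bX_size ltnS size_polyC_leq1.
have [||p [p_pr p_fixed]|t ltNt Ft_pr] := Dickson s F s_gt0 _ _ _ N.
- by move=> i; rewrite size_polyDl // bX_size.
- move=> i; rewrite /F lead_coefDl // lead_coefZ lead_coefX mulr1.
  by rewrite ltz_nat b_gt0.
- have [t tP] := not_fixed p p_pr.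
  have := p_fixed (Posz t); rewrite horner_prod.
  under eq_bigr do rewrite FE.
  rewrite -(big_morph Posz PoszM (erefl 1%Z)) dvdzE /= Euclid_dvd_prod //.
  rewrite big_has => /hasP[i _]; apply/negP; exact: tP.
exists t => // i lt_is.
by have [p p_pr] := Ft_pr (Ordinal lt_is); rewrite FE => -[->].
Qed.

(** A prime dividing all values of [a + m * t] divides the values at [0] and
    [1], hence [a] and [m]. *)
Lemma Dirichlet_of_Dickson (a m N : nat) :
  Dickson_conjecture -> 0 < m -> coprime a m ->
  exists q, [/\ N < q, prime q & q = a %[mod m]].
Proof.
move=> Dickson m_gt0 co_am.
have [||t ltNt q_pr] :=
    @Dickson_nat 1 (fun=> a) (fun=> m) N Dickson (ltn0Sn 0).
- by [].
- move=> p p_pr; have [p_a|pNa] := boolP (p %| a); last first.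
    by exists 0 => i _; rewrite muln0 addn0.
  exists 1 => i _; rewrite muln1 dvdn_addr //.
  apply/negP => p_m.
  have : p %| gcdn a m by rewrite dvdn_gcd p_a.
  by rewrite (eqP co_am) dvdn1; case: p p_pr {p_a p_m} => [|[]].
exists (a + m * t); split; [|exact: (q_pr 0)|by rewrite addnC mulnC modnMDl].
by apply: leq_trans ltNt _; rewrite (leq_trans (leq_pmull t m_gt0)) ?leq_addl.
Qed.

(** * Totients in prescribed residue classes *)

(** Squares rather than primes are used as moduli because the class modulo [4]
    has to be prescribed along with the classes modulo odd primes. *)
Lemma chinese_prime_squares (r : nat -> nat) (s : seq nat) :
  uniq s -> all prime s ->
  exists a, {in s, forall p, a = r p %[mod p ^ 2]}.
Proof.
elim: s => [|p s IHs] /=; first by exists 0.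
case/andP=> pNs s_uniq /andP[p_pr s_pr].
have [a aP] := IHs s_uniq s_pr.
pose m := \prod_(l <- s) l ^ 2.
have co_pm : coprime (p ^ 2) m.
  rewrite coprimeXl // /m big_seq; elim/big_ind: _ => [|x y cox coy|l l_s].
  - exact: coprimen1.
  - by rewrite coprimeMr cox.
  rewrite coprimeXr // prime_coprime // dvdn_prime2 //;
    last exact: (allP s_pr).
  by apply: contraNneq pNs => ->.
exists (chinese (p ^ 2) m (r p) a); move=> l; rewrite inE => /predU1P[->|l_s].
  exact: chinese_modl.
have l2m : l ^ 2 %| m by rewrite /m (big_rem l) //= dvdn_mulr.
rewrite -(aP l l_s) -[LHS](modn_dvdm _ l2m) -[RHS](modn_dvdm _ l2m).
by rewrite chinese_modr.
Qed.

(** The witness is a prime [q], or its square when [3] divides [c + 1].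
    Modulo an odd prime [l] the class of [q] is [2] or [3].  For [l > 3] the two
    resulting totients differ by [1] or by [4], so that [l] cannot divide both
    of them plus [c].  For [l = 3] the class must be [2], and the exponent is
    chosen for it. *)
Lemma totient_avoiding (c B : nat) :
  Dickson_conjecture ->
  exists w, [/\ 0 < w, B < totient w, totient w %% 4 = 2 &
    forall l, prime l -> odd l -> l <= B ->
      ~~ (l %| totient w) /\ ~~ (l %| totient w + c)].
Proof.
move=> Dickson.
pose e : nat := 3 %| c + 1.
pose phi q := q.-1 * q ^ e.
have phi_mod l q r : 0 < q -> 0 < r -> q = r %[mod l] -> phi q = phi r %[mod l].
  case: q => // q; case: r => // r _ _ qr.
  rewrite /phi -modnMm -[in RHS]modnMm -(modnXm e l q.+1) qr modnXm.
  congr (_ * _ %% _); apply/eqP.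
  by rewrite -(eqn_modDr 1) !addn1; apply/eqP.
pose ok l r := ~~ (l %| phi r + c).
pose r (l : nat) := if l == 2 then 3 else if ok l 2 then 2 else 3.
have r_ge2 l : 2 <= r l by rewrite /r; case: ifP => // _; case: ifP.
have rP l : prime l -> odd l ->
    [/\ ~~ (l %| r l), ~~ (l %| phi (r l)) & ~~ (l %| phi (r l) + c)].
  move=> l_pr l_odd.
  have l_ge3 : 2 < l by case: l l_pr l_odd => [|[|[|]]].
  have [phi2 phi3] : phi 2 = 2 ^ e /\ phi 3 = 2 * 3 ^ e by rewrite /phi mul1n.
  have lN n : n < l -> 0 < n -> ~~ (l %| n).
    by move=> lt_nl n_gt0; rewrite gtnNdvd.
  rewrite /r; have -> : l == 2 = false by apply/eqP=> l2; rewrite l2 in l_odd.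
  (* Modulo 3 the totient of q is 1, and that of its square is 2. *)
  have [l3|lN3] := eqVneq l 3.
    have ok32 : ok 3 2.
      rewrite /ok phi2 /e.
      by case: (boolP (3 %| c + 1)); rewrite ?expn0 ?expn1; lia.
    rewrite l3 ok32; split=> //.
    by rewrite phi2 /e; case: (3 %| c + 1).
  have l_ge5 : 4 < l by lia.
  (* The four candidates are 1 and 2, or 2 and 6. *)
  have lN6 : ~~ (l %| 6).
    apply/negP => l6; have := dvdn_leq (ltn0Sn 5) l6.
    by case: l l_ge5 l6 l_odd {lN3 l_pr l_ge3 lN} => [|[|[|[|[|[|[|]]]]]]].
  case: ifPn => [ok2|].
    split=> //; first by apply: lN; lia.
    by rewrite phi2 /e; case: (3 %| _); rewrite ?expn0 ?expn1 lN //; lia.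
  rewrite /ok negbK => l2c; split; first by apply: lN; lia.
    by rewrite phi3 /e; case: (3 %| _) => //; rewrite expn0 lN //; lia.
  apply/negP => l3c; have := dvdn_sub l3c l2c; apply/negP.
  rewrite subnDr phi2 phi3 /e; case: (3 %| _); rewrite ?expn0 ?expn1 lN //; lia.
pose s := primes (B.+2)`!.
have s_mem l : prime l -> l <= B.+2 -> l \in s.
  by move=> l_pr le_lB; rewrite mem_primes l_pr fact_gt0 dvdn_fact // prime_gt0.
have s_pr : all prime s by apply/allP => l; rewrite mem_primes => /andP[].
have [a aP] := chinese_prime_squares r s (primes_uniq _) s_pr.
pose m := \prod_(l <- s) l ^ 2.
have m_gt0 : 0 < m.
  rewrite /m big_seq prodn_cond_gt0 // => l l_s.
  by rewrite expn_gt0 prime_gt0 // (allP s_pr).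
have co_am : coprime a m.
  rewrite /m big_seq; elim/big_ind: _ => [|x y cox coy|l l_s].
  - exact: coprimen1.
  - by rewrite coprimeMr cox.
  have l_pr := allP s_pr _ l_s.
  rewrite coprimeXr // coprime_sym prime_coprime //.
  have l_l2 : l %| l ^ 2 by rewrite dvdn_exp.
  rewrite /dvdn -(modn_dvdm a l_l2) (aP l l_s) modn_dvdm // -/(dvdn l (r l)).
  have [->//|lN2] := eqVneq l 2.
  have l_odd : odd l by case: (even_prime l_pr) lN2 => [->|].
  by have [] := rP l l_pr l_odd.
have [q [lt_Bq q_pr qa]] := Dirichlet_of_Dickson a m B.+2 Dickson m_gt0 co_am.
have q_r l : prime l -> l <= B.+2 -> q = r l %[mod l ^ 2].
  move=> l_pr /(s_mem l l_pr) l_s; rewrite -(aP l l_s).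
  have l2m : l ^ 2 %| m by rewrite /m (big_rem l) //= dvdn_mulr.
  by rewrite -(modn_dvdm q l2m) qa modn_dvdm.
have tot : totient (q ^ e.+1) = phi q by rewrite totient_pfactor.
exists (q ^ e.+1); rewrite tot; split.
- by rewrite expn_gt0 prime_gt0.
- rewrite /phi; apply: leq_trans (leq_pmulr _ _); first lia.
  by rewrite expn_gt0 prime_gt0.
- (* Since q is 3 modulo 4, both q - 1 and q * (q - 1) are 2 modulo 4. *)
  have := q_r 2 isT isT; rewrite (_ : r 2 = 3) // => q3.
  rewrite (phi_mod _ _ 3) ?prime_gt0 // /phi /e.
  by case: (3 %| _).
move=> l l_pr l_odd le_lB; have [lNr lNphi lNphic] := rP l l_pr l_odd.
have phi_r : phi q = phi (r l) %[mod l].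
  apply: phi_mod; [exact: prime_gt0 | exact: ltnW (r_ge2 l) |].
  have l_l2 : l %| l ^ 2 by rewrite dvdn_exp.
  rewrite -(modn_dvdm q l_l2) q_r ?modn_dvdm //.
  by rewrite (leq_trans le_lB) // -addn2 leq_addr.
by rewrite /dvdn -modnDml phi_r modnDml.
Qed.

(** * Compatible families of totients *)

(** Each of the [s] forms has at most one root modulo [p], and there are more
    than [s] residue classes. *)
Lemma avoid_zeros (s p : nat) (a : nat -> nat) (b : nat) :
  prime p -> ~~ (p %| b) -> s < p ->
  exists t, forall i, i < s -> ~~ (p %| a i + b * t).
Proof.
move=> p_pr pNb lt_sp.
have [t /forallP tP|all_bad] :=
    pickP [pred t : 'I_p | [forall i : 'I_s, ~~ (p %| a i + b * t)]].
  by exists t => i lt_is; apply: (tP (Ordinal lt_is)).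
have bad (t : 'I_p) : {i : 'I_s | p %| a i + b * t}.
  apply/sigW; have /negbT := all_bad t; rewrite negb_forall => /existsP[i].
  by rewrite negbK; exists i.
have bad_inj : injective (fun t => sval (bad t)).
  move=> t u; case: (bad t) (bad u) => i pi [j pj] /= eq_ij; subst j.
  have dvd_sub (x y : 'I_p) : p %| a i + b * x -> p %| a i + b * y -> x <= y.
    move=> px py; rewrite leqNgt; apply/negP => lt_yx.
    have := dvdn_sub px py; rewrite subnDl -mulnBr Euclid_dvdM // (negPf pNb) /=.
    by rewrite gtnNdvd ?subn_gt0 // (leq_ltn_trans (leq_subr _ _)).
  by apply/val_inj/anti_leq; rewrite /= !dvd_sub.
by have := leq_card _ bad_inj; rewrite !card_ord leqNgt lt_sp.
Qed.

(** The state of the construction after [k] totients: [M] is determined modulo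
    [L], and for [t] in [nat] the numbers [(M + 4 * h + L * t) / totient (w h)
    + 1] are the future linear forms.  The last three fields control them modulo
    an odd prime [l] dividing [L]: by [base_avoids] a form that is constant
    modulo [l] is nonzero; by [modulus_exact] the form of index [h] is not
    constant if [l] divides [totient (w h)]; and by [totient_disjoint] this
    happens for at most one index. *)
Record compatible (H k L M : nat) (w : nat -> nat) : Prop := Compatible {
  modulus_gt0 : 0 < L;
  four_dvd_modulus : 4 %| L;
  four_dvd_base : 4 %| M;
  small_dvd_modulus : forall l, prime l -> l <= H -> l %| L;
  witness_gt0 : forall h, 0 < h <= k -> 0 < w h;
  totient_mod4 : forall h, 0 < h <= k -> totient (w h) %% 4 = 2;
  totient_gt : forall h, 0 < h <= k -> 4 * H < totient (w h);
  totient_dvd_modulus : forall h, 0 < h <= k -> totient (w h) %| L;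
  totient_dvd_base : forall h, 0 < h <= k -> totient (w h) %| M + 4 * h;
  base_avoids : forall h l, 0 < h <= k -> prime l -> odd l ->
    l %| L -> ~~ (l %| totient (w h)) -> ~~ (l %| M + 4 * h + totient (w h));
  modulus_exact : forall h l, 0 < h <= k -> prime l -> odd l ->
    l %| totient (w h) -> ~~ (l * totient (w h) %| L);
  totient_disjoint : forall h j l, 0 < h <= k -> 0 < j <= k -> prime l ->
    odd l -> l %| totient (w h) -> l %| totient (w j) -> h = j
}.

Lemma compatible0 (H : nat) : compatible H 0 (4 * H`!) 0 (fun=> 1).
Proof.
split=> //; try by case.
- by rewrite muln_gt0 fact_gt0.
- exact: dvdn_mulr.
- by move=> l l_pr le_lH; rewrite dvdn_mull // dvdn_fact // prime_gt0.
Qed.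

(** The new totient [d = 2 * u] is taken with all its odd prime factors above a
    bound that exceeds [L] and [4 * H].  Then [u] is coprime to [L], so that
    [M] can be adjusted modulo [u].  For a prime factor [l] of [u] and an old
    index [h], the form vanishes modulo [l] only if [l] divides
    [totient (w h) - 4 * (k + 1 - h)], which is positive and smaller than [l].
    For odd primes dividing [L], the new form is nonzero by the choice of [d]. *)
Lemma compatibleS (H k L M : nat) (w : nat -> nat) :
  Dickson_conjecture -> k < H -> compatible H k L M w ->
  exists L' M' w', compatible H k.+1 L' M' w'.
Proof.
move=> Dickson lt_kH.
move=> [L_gt0 L4 M4 L_small w_gt0 d_mod4 d_gt d_L d_M avoid exact disj].
have [v [v_gt0 d_large d4 d_avoid]] :=
  totient_avoiding (M + 4 * k.+1) (L + 4 * H) Dickson.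
set d := totient v in d_large d4 d_avoid.
pose u := d %/ 2.
have dE : d = 2 * u by rewrite /u; lia.
have u_odd : odd u by lia.
have d_coL l : prime l -> odd l -> l %| d -> L + 4 * H < l.
  move=> l_pr l_odd l_d; rewrite ltnNge; apply/negP => /(d_avoid l l_pr l_odd)[].
  by rewrite l_d.
have le_L l : l %| L -> l <= L + 4 * H.
  by move=> /(dvdn_leq L_gt0) le_lL; apply: leq_trans le_lL (leq_addr _ _).
have u_prime l : prime l -> l %| u -> odd l /\ L + 4 * H < l.
  move=> l_pr l_u; have l_odd := dvdn_odd l_u u_odd.
  by split=> //; apply: d_coL => //; rewrite dE dvdn_mull.
have co_Lu : coprime L u.
  rewrite /coprime; apply: contraT => g_neq1.
  have g_gt1 : 1 < gcdn L u by rewrite ltn_neqAle eq_sym g_neq1 gcdn_gt0 L_gt0.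
  have := pdiv_dvd (gcdn L u); rewrite dvdn_gcd => /andP[/le_L p_L].
  by move=> /(u_prime _ (pdiv_prime g_gt1))[_]; rewrite ltnNge p_L.
(* The second residue is - 4 * (k + 1) modulo u. *)
pose M' := chinese L u M (4 * k.+1 * u.-1).
have M'_L l : l %| L -> M' = M %[mod l].
  by move=> l_L; rewrite -(modn_dvdm M' l_L) chinese_modl // modn_dvdm.
have M'_dvd l x : l %| L -> (l %| M' + x) = (l %| M + x).
  by move=> l_L; rewrite /dvdn -modnDml M'_L // modnDml.
have d_M' : d %| M' + 4 * k.+1.
  rewrite dE Gauss_dvd; last by rewrite coprime2n.
  have L2 : 2 %| L by apply: dvdn_trans L4.
  apply/andP; split; first by rewrite M'_dvd // ; lia.
  rewrite /dvdn -modnDml chinese_modr // modnDml -mulnSr.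
  by rewrite prednK ?odd_gt0 // modnMl.
pose w' h := if h == k.+1 then v else w h.
have w'_new : w' k.+1 = v by rewrite /w' eqxx.
have w'_old h : 0 < h <= k -> w' h = w h.
  by move=> h_le; rewrite /w'; case: eqP => // eq_h; lia.
have idx h : 0 < h <= k.+1 -> 0 < h <= k \/ h = k.+1 by lia.
have d_le h : 0 < h <= k -> totient (w h) <= L.
  by move=> h_le; apply: dvdn_leq => //; apply: d_L.
have gap h x l m : 0 < h <= k -> 4 * H < x -> x <= L -> L + 4 * H < l ->
    0 < m + 4 * h + x - (m + 4 * k.+1) < l.
  by clear -lt_kH; lia.
exists (L * u), M', w'; split.
- by rewrite muln_gt0 L_gt0 odd_gt0.
- exact: dvdn_mulr.
- by have := M'_dvd 4 0 L4; rewrite !addn0 => ->.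
- by move=> l l_pr le_lH; rewrite dvdn_mulr ?L_small.
- by move=> h /idx[h_le|->]; rewrite ?w'_new // w'_old ?w_gt0.
- by move=> h /idx[h_le|->]; rewrite ?w'_new // w'_old ?d_mod4.
- move=> h /idx[h_le|->]; rewrite ?w'_new ?w'_old ?d_gt //.
  exact: leq_ltn_trans (leq_addl _ _) d_large.
- move=> h /idx[h_le|->]; rewrite ?w'_new ?w'_old //.
    by rewrite dvdn_mulr ?d_L.
  by rewrite -/d dE dvdn_mul //; apply: dvdn_trans L4.
- move=> h /idx[h_le|->//]; rewrite ?w'_new ?w'_old //.
  by rewrite M'_dvd ?d_M ?d_L.
- move=> h l /idx[h_le|->] l_pr l_odd; rewrite ?w'_new ?w'_old // Euclid_dvdM //.
    case/orP=> [l_L lNd|l_u lNd]; first by rewrite -addnA M'_dvd // addnA avoid.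
    have l_d : l %| d by rewrite dE dvdn_mull.
    have l_large := d_coL l l_pr l_odd l_d.
    have l_M' : l %| M' + 4 * k.+1 by apply: dvdn_trans l_d d_M'.
    apply/negP => l_sum; have := dvdn_sub l_sum l_M'.
    have /andP[gap_gt0 gap_lt] :=
      gap h _ l M' h_le (d_gt h h_le) (d_le h h_le) l_large.
    by rewrite gtnNdvd.
  case/orP=> [l_L _|l_u]; last by rewrite -/d dE dvdn_mull.
  rewrite -addnA M'_dvd // addnA addnC.
  by have [] := d_avoid l l_pr l_odd (le_L l l_L).
- move=> h l /idx[h_le|->] l_pr l_odd; rewrite ?w'_new ?w'_old // => l_d.
    have d_u : coprime (totient (w h)) u := coprime_dvdl (d_L h h_le) co_Lu.
    rewrite Gauss_dvdl ?coprimeMl ?d_u ?(coprime_dvdl l_d) //.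
    exact: exact.
  rewrite -/d dE mulnA dvdn_pmul2r ?odd_gt0 //; apply/negP => l2_L.
  have := le_L l (dvdn_trans (dvdn_mulr 2 (dvdnn l)) l2_L).
  by rewrite leqNgt d_coL.
have new_old h l : 0 < h <= k -> prime l -> odd l ->
    l %| d -> l %| totient (w h) -> False.
  move=> h_le l_pr l_odd l_d l_dh.
  have := le_L l (dvdn_trans l_dh (d_L h h_le)).
  by rewrite leqNgt d_coL.
move=> h j l /idx[h_le|->] /idx[j_le|->] l_pr l_odd; rewrite ?w'_new ?w'_old //.
- exact: disj.
- by move=> l_dh l_d; case: (new_old h l).
- by move=> l_d l_dj; case: (new_old j l).
Qed.

Lemma exists_compatible (H k : nat) :
  Dickson_conjecture -> k <= H -> exists L M w, compatible H k L M w.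
Proof.
move=> Dickson; elim: k => [_|k IHk lt_kH].
  by exists (4 * H`!), 0, (fun=> 1); apply: compatible0.
by have [L [M [w wP]]] := IHk (ltnW lt_kH); apply: compatibleS wP.
Qed.

(** * Absence of fixed prime divisors *)

(** Multiplying the form of index [h] by [totient (w h)] gives
    [M + 4 * h + totient (w h) + L * t], which handles all odd primes not
    dividing [totient (w h)]. *)
Lemma compatible_not_fixed (H L M : nat) (w : nat -> nat) (p : nat) :
  compatible H H L M w -> prime p ->
  exists t, forall h, 0 < h <= H ->
    ~~ (p %| (M + 4 * h) %/ totient (w h) + 1 + L %/ totient (w h) * t).
Proof.
move=> [L_gt0 L4 M4 L_small _ d_mod4 _ d_L d_M avoid exact disj] p_pr.
pose d h := totient (w h).
pose F h t := (M + 4 * h) %/ d h + 1 + L %/ d h * t.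
have F_mul h t : 0 < h <= H -> F h t * d h = M + 4 * h + d h + L * t.
  move=> h_le; rewrite /F !mulnDl mul1n divnK ?d_M // mulnAC divnK ?d_L //.
have [p2|pN2] := eqVneq p 2.
  exists 0 => h h_le; rewrite p2 muln0 addn0.
  have := d_M h h_le; have := d_mod4 h h_le; have := M4.
  move: (totient _) => x M4' x4 /dvdnP[y My]; rewrite My.
  rewrite mulnK; last by lia.
  have : 4 %| y * x by rewrite -My; lia.
  have -> : x = 2 * (x %/ 2) by lia.
  rewrite mulnCA (@dvdn_pmul2l 2 2) // Gauss_dvdl ?coprime2n; lia.
have p_odd : odd p by case: (even_prime p_pr) pN2 => [->|].
have [p_L|pNL] := boolP (p %| L); last first.
  have lt_Hp : H < p by rewrite ltnNge; apply: contra pNL; apply: L_small.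
  have [t tP] :=
    avoid_zeros H p (fun i => M + 4 * i.+1 + d i.+1) L p_pr pNL lt_Hp.
  exists t => h h_le; apply/negP => p_F.
  have := tP h.-1; rewrite prednK; last by lia.
  rewrite -F_mul // dvdn_mulr // => /(_ _)/negP; apply=> //; lia.
have F_avoid h t : 0 < h <= H -> ~~ (p %| d h) -> ~~ (p %| F h t).
  move=> h_le pNd; apply/negP => p_F.
  have : p %| F h t * d h by rewrite dvdn_mulr.
  rewrite F_mul // dvdn_addl; last by rewrite dvdn_mulr.
  by apply/negP; apply: avoid.
have [/existsP[j /andP[j_gt0 p_dj]]|no_dvd] :=
    boolP [exists j : 'I_H.+1, (0 < j) && (p %| d j)]; last first.
  exists 0 => h h_le; apply: F_avoid => //; apply: contra no_dvd => p_d.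
  have lt_hH : h < H.+1 by lia.
  by apply/existsP; exists (Ordinal lt_hH); rewrite /= p_d; lia.
have j_le : 0 < j <= H by rewrite j_gt0 -ltnS /=.
(* The form of index j is not constant modulo p: it cannot vanish at both 0
   and 1. *)
have [t t_ok] : exists t, ~~ (p %| F j t).
  have [p_F0|] := boolP (p %| F j 0); last by exists 0.
  exists 1; rewrite /F muln1; rewrite /F muln0 addn0 in p_F0.
  rewrite dvdn_addr //; have := exact j p j_le p_pr p_odd p_dj.
  by apply: contra => p_Ld; rewrite -dvdn_divRL ?d_L.
exists t => h h_le; have [p_dh|/(F_avoid h t h_le)//] := boolP (p %| d h).
by rewrite (disj h j p).
Qed.

Theorem theorem1p3 (HDickson : Dickson_conjecture) (H : nat) (hH : (0 < H)%N) :
  exists (M : nat) (m : nat -> nat),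
    (0 < M)%N /\
    forall h : nat, (1 <= h <= H)%N ->
      (0 < m h)%N /\ totient (m h) = (M + 4 * h)%N.
Proof.
have [L [M [w wP]]] := exists_compatible H H HDickson (leqnn H).
have [L_gt0 _ _ _ w_gt0 _ _ d_L d_M _ _ _] := wP.
pose a h := (M + 4 * h) %/ totient (w h) + 1.
pose b h := L %/ totient (w h).
have b_gt0 h : 0 < h <= H -> 0 < b h.
  move=> h_le; rewrite divn_gt0 ?totient_gt0 ?w_gt0 //.
  exact: dvdn_leq L_gt0 (d_L h h_le).
(* The bound on t makes the primes larger than all w h, so coprime to them. *)
have [i lt_iH|p p_pr|t ltNt p_pr] :=
  Dickson_nat H (fun i => a i.+1) (fun i => b i.+1)
    (\sum_(h < H.+1) w h) HDickson hH.
- exact: b_gt0.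
- have [t tP] := compatible_not_fixed H L M w p wP p_pr.
  by exists t => i lt_iH; apply: tP.
have t_gt0 : 0 < t by lia.
exists (M + L * t), (fun h => w h * (a h + b h * t)); split.
  by rewrite addn_gt0 muln_gt0 L_gt0 t_gt0 orbT.
move=> h h_le; have w_pos := w_gt0 h h_le.
have q_pr : prime (a h + b h * t).
  by have := p_pr h.-1; rewrite prednK; [apply; lia | lia].
split; first by rewrite muln_gt0 w_pos prime_gt0.
have lt_wq : w h < a h + b h * t.
  have w_sum : w h <= \sum_(i < H.+1) w i.
    have lt_hH : h < H.+1 by lia.
    by rewrite (bigD1 (Ordinal lt_hH)) //= leq_addr.
  apply: leq_ltn_trans w_sum (leq_trans ltNt _).
  by rewrite (leq_trans (leq_pmull t (b_gt0 h h_le))) ?leq_addl.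
have co_wq : coprime (w h) (a h + b h * t).
  by rewrite coprime_sym prime_coprime // gtnNdvd.
rewrite totient_coprime // (totient_prime q_pr) /a addnAC addn1 /= mulnDr /b.
rewrite mulnA ![totient _ * (_ %/ _)]mulnC !divnK; first lia.
- exact: d_L.
- exact: d_M.
Qed.
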